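(* Let $n,k\ge 1$ and let $\mathbf{C}=(C_0,C_1,\dots,C_k)$ be a $(k+1)$-tuple of real $n\times n$ matrices having the column sufficient-$W$ (cS-$W$) property. If $C_0$ is an $M$-matrix, then for every $q\in\mathbb{R}^n_{++}$ and every $\mathbf{d}=(d_1,\dots,d_{k-1})$ with all $d_j\in\mathbb{R}^n_{++}$, the problem $\mathrm{EHLCP}(\mathbf{C},\mathbf{d},q)$ has a unique solution.
   Context: Notation: $[m]=\{1,\dots,m\}$; $\mathbb{R}^n_{++}$ is the set of vectors in $\mathbb{R}^n$ with all entries positive; for $u,v\in\mathbb{R}^n$, $u*v$ is the componentwise product, $u\wedge v$ is the componentwise minimum, and $u\ge 0$, $u\le 0$ are understood componentwise. $M$-matrix: a real square matrix whose off-diagonal entries are all nonpositive and which is invertible with entrywise nonnegative inverse. cS-$W$ property: $\mathbf{C}=(C_0,\dots,C_k)$ has the cS-$W$ property if for all $x_0,x_1,\dots,x_k\in\mathbb{R}^n$ with $C_0x_0=\sum_{i=1}^k C_ix_i$, $x_0*x_i\le 0$ for all $i\in[k]$, and $x_i*x_j\ge 0$ for all $1\le i<j\le k$, one has $x_i*x_{i+1}=0$ for all $0\le i\le k-1$. EHLCP: for $q\in\mathbb{R}^n$ and $\mathbf{d}=(d_1,\dots,d_{k-1})$ with $d_j\in\mathbb{R}^n_{++}$ (empty tuple if $k=1$), $\mathrm{EHLCP}(\mathbf{C},\mathbf{d},q)$ is the problem of finding $(x_0,x_1,\dots,x_k)\in(\mathbb{R}^n)^{k+1}$ such that $C_0x_0=q+\sum_{i=1}^kC_ix_i$,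 $x_0\wedge x_1=0$, and $(d_j-x_j)\wedge x_{j+1}=0$ for all $j\in[k-1]$. *)

(* Defs.v *)
From mathcomp Require Import all_boot all_order all_algebra.
From mathcomp Require Import reals.

Set Implicit Arguments.
Unset Strict Implicit.
Unset Printing Implicit Defensive.

Import Order.TTheory GRing.Theory Num.Theory.

Local Open Scope ring_scope.

Section Defs.
Variables (R : realType) (n : nat).

Definition cvpos (u : 'cV[R]_n) : Prop := forall i, 0 < u i ord0.
Definition cvge0 (u : 'cV[R]_n) : Prop := forall i, 0 <= u i ord0.
Definition cvle0 (u : 'cV[R]_n) : Prop := forall i, u i ord0 <= 0.

Definition cvmul (u v : 'cV[R]_n) : 'cV[R]_n := map2_mx *%R u v.
Definition cvmin (u v : 'cV[R]_n) : 'cV[R]_n := map2_mx Num.min u v.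

Definition M_matrix (A : 'M[R]_n) : Prop :=
  [/\ forall i j, i != j -> A i j <= 0,
      A \in unitmx
    & forall i j, 0 <= invmx A i j].

Variable k : nat.

(* A tuple (z_0, ..., z_k) is a function on 'I_k.+1. *)

Definition cSW (C : {ffun 'I_k.+1 -> 'M[R]_n}) : Prop :=
  forall x : {ffun 'I_k.+1 -> 'cV[R]_n},
    C ord0 *m x ord0 = \sum_(i < k.+1 | (1 <= i)%N) C i *m x i ->
    (forall i : 'I_k.+1, (1 <= i)%N -> cvle0 (cvmul (x ord0) (x i))) ->
    (forall i j : 'I_k.+1, (1 <= i < j)%N -> cvge0 (cvmul (x i) (x j))) ->
  forall i : nat, (i < k)%N -> cvmul (x (inord i)) (x (inord i.+1)) = 0.

(* d is indexed from 0: the vector d_j (1 <= j <= k-1) is d at j-1.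
   Both uses of inord are in range, as j.+2 <= k for j < k.-1. *)
Definition EHLCP (C : {ffun 'I_k.+1 -> 'M[R]_n})
    (d : {ffun 'I_k.-1 -> 'cV[R]_n}) (q : 'cV[R]_n)
    (x : {ffun 'I_k.+1 -> 'cV[R]_n}) : Prop :=
  [/\ C ord0 *m x ord0 = q + \sum_(i < k.+1 | (1 <= i)%N) C i *m x i,
      cvmin (x ord0) (x (inord 1)) = 0
    & forall j : 'I_k.-1,
        cvmin (d j - x (inord j.+1)) (x (inord j.+2)) = 0].

End Defs.

(* Main.v *)
Require Import Defs.
From mathcomp Require Import all_boot all_order all_algebra.
From mathcomp Require Import reals.

(** For positive [q] one solution is visible: since [C_0] has a nonnegative
    inverse, [p = C_0^-1 q] is entrywise positive ([nonneg_inv_pos]), and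
    [(p, 0, ..., 0)] satisfies every complementarity condition.

    This solution is the only one.  In a solution [y], each coordinate fills up
    the levels [y_1, y_2, ...] in order: [y_(j+1)] can be nonzero only where
    [y_j] has reached the bound [d_j > 0].  So where [y_1] vanishes, all later
    levels vanish ([EHLCP_level1_eq0]), and where it does not, [y_0 = 0].
    Subtracting the visible solution from [y] gives [(y_0 - p, y_1, ..., y_k)],
    which solves the homogeneous equation and has the sign pattern required by
    the cS-W property: wherever some [y_j] is positive, [y_0 - p = - p] is
    negative.  The property yields [(y_0 - p) * y_1 = 0]; a coordinate with
    [y_1 <> 0] would give [- p * y_1 = 0] with [p > 0], so [y_1 = 0].  Then all
    levels vanish and the linear equation forces [y_0 = p]. *)

Import Order.TTheory GRing.Theory Num.Theory.

Local Open Scope ring_scope.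

Lemma min_eq0 (R : realDomainType) (a b : R) :
  Num.min a b = 0 -> [/\ 0 <= a, 0 <= b & a != 0 -> b = 0].
Proof.
move=> ab0.
have a0 : 0 <= a by rewrite -ab0 ge_min lexx.
have b0 : 0 <= b by rewrite -ab0 ge_min lexx orbT.
split=> // aN0; move: ab0; rewrite /Num.min; case: ifP => // _ a00.
by rewrite a00 eqxx in aN0.
Qed.

(** An invertible matrix has no zero row, so each entry of the product has at
    least one positive summand. *)
Lemma nonneg_inv_pos (R : realType) (n : nat) (A : 'M[R]_n) (q : 'cV[R]_n) :
  A \in unitmx -> (forall i j, 0 <= invmx A i j) -> cvpos q ->
  cvpos (invmx A *m q).
Proof.
move=> Au A0 q0 i; rewrite mxE lt_neqAle sumr_ge0 ?andbT; last first.
  by move=> j _; rewrite mulr_ge0 // ltW.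
apply/negP; rewrite eq_sym psumr_eq0; last first.
  by move=> j _; rewrite mulr_ge0 // ltW.
move=> /allP row0.
have := congr1 (fun M : 'M_n => M i i) (mulVmx Au).
rewrite !mxE eqxx big1 => [/esym/eqP|j _]; first by rewrite oner_eq0.
have := row0 j (mem_index_enum j).
by rewrite /= mulf_eq0 (gt_eqF (q0 j)) orbF => /eqP ->; rewrite mul0r.
Qed.

Section EHLCPLevels.
Set Implicit Arguments.
Variables (R : realType) (n k : nat) (C : {ffun 'I_k.+1 -> 'M[R]_n}).
Variables (d : {ffun 'I_k.-1 -> 'cV[R]_n}) (q : 'cV[R]_n).
Variable y : {ffun 'I_k.+1 -> 'cV[R]_n}.
Hypothesis (y_sol : EHLCP C d q y).

Lemma EHLCP_level01 (i : 'I_n) :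
  [/\ 0 <= y ord0 i ord0, 0 <= y (inord 1) i ord0
    & y ord0 i ord0 != 0 -> y (inord 1) i ord0 = 0].
Proof.
case: y_sol => _ /(congr1 (fun v : 'cV_n => v i ord0)) + _.
by rewrite !mxE => /min_eq0.
Qed.

Lemma EHLCP_level_succ (j : 'I_k.-1) (i : 'I_n) :
  0 <= y (inord j.+2) i ord0 /\
  (d j i ord0 != y (inord j.+1) i ord0 -> y (inord j.+2) i ord0 = 0).
Proof.
case: y_sol => _ _ /(_ j) /(congr1 (fun v : 'cV_n => v i ord0)).
by rewrite !mxE -subr_eq0 => /min_eq0[].
Qed.

Lemma EHLCP_level_ge0 (j : 'I_k.+1) (i : 'I_n) : 0 <= y j i ord0.
Proof.
rewrite -(inord_val j); case: j => -[|[|m]] /= mk.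
- have -> : inord 0 = ord0 :> 'I_k.+1 by apply: val_inj; rewrite /= inordK.
  by case: (EHLCP_level01 i).
- by case: (EHLCP_level01 i).
- have mk1 : (m < k.-1)%N by case: (k) mk.
  by case: (EHLCP_level_succ (Ordinal mk1) i).
Qed.

(** Where a level vanishes it lies strictly below its bound [d_j > 0], which
    forces the next level to vanish too. *)
Lemma EHLCP_level1_eq0 (i : 'I_n) :
  (forall j, cvpos (d j)) -> y (inord 1) i ord0 = 0 ->
  forall j : 'I_k.+1, (1 <= j)%N -> y j i ord0 = 0.
Proof.
move=> d_pos y1 [[//|m] mk] _; rewrite -(inord_val (Ordinal mk)) /=.
elim: m mk => // m IHm mk.
have mk1 : (m < k.-1)%N by case: (k) mk.
have [_ next0] := EHLCP_level_succ (Ordinal mk1) i.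
by apply: next0; rewrite /= (IHm (ltnW mk)) gt_eqF //; apply: d_pos.
Qed.

End EHLCPLevels.

Lemma EHLCP_trivial_sol (R : realType) (n k : nat)
    (C : {ffun 'I_k.+1 -> 'M[R]_n}) (d : {ffun 'I_k.-1 -> 'cV[R]_n})
    (q p : 'cV[R]_n) :
  (1 <= k)%N -> (forall j, cvpos (d j)) -> C ord0 *m p = q -> cvpos p ->
  EHLCP C d q [ffun i => if i == ord0 then p else 0].
Proof.
move=> k_ge1 d_pos Cp p_pos.
have inordN0 m : (m < k)%N -> (inord m.+1 == ord0 :> 'I_k.+1) = false.
  by move=> mk; rewrite -val_eqE /= inordK.
split=> [||j].
- rewrite ffunE eqxx Cp big1 ?addr0 // => i i_ge1.
  by rewrite ffunE -val_eqE /= gtn_eqF // mulmx0.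
- apply/matrixP=> i o; rewrite (ord1 o) !ffunE eqxx inordN0 // !mxE.
  by apply/min_idPr/ltW.
- have jk : (j.+1 < k)%N by case: (k) j => [[]|k' []].
  apply/matrixP=> i o; rewrite (ord1 o) !ffunE !inordN0 ?(ltnW jk) // !mxE.
  by rewrite subr0; apply/min_idPr/ltW/d_pos.
Qed.

Theorem theorem3p3 (R : realType) (n k : nat) (n_ge1 : (1 <= n)%N)
    (k_ge1 : (1 <= k)%N) (C : {ffun 'I_k.+1 -> 'M[R]_n}) (C_cSW : cSW C)
    (C0_M : M_matrix (C ord0)) (q : 'cV[R]_n) (q_pos : cvpos q)
    (d : {ffun 'I_k.-1 -> 'cV[R]_n}) (d_pos : forall j, cvpos (d j)) :
  exists! x : {ffun 'I_k.+1 -> 'cV[R]_n}, EHLCP C d q x.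
Proof.
have [_ C0_unit C0inv_ge0] := C0_M.
have [p C0p p_pos] : exists2 p, C ord0 *m p = q & cvpos p.
  exists (invmx (C ord0) *m q); first by rewrite mulKVmx.
  exact: nonneg_inv_pos.
exists [ffun i => if i == ord0 then p else 0]; split.
  exact: EHLCP_trivial_sol.
move=> y y_sol; have [y_lin _ _] := y_sol.
pose z : {ffun 'I_k.+1 -> 'cV[R]_n} :=
  [ffun i => if i == ord0 then y ord0 - p else y i].
have z0 : z ord0 = y ord0 - p by rewrite ffunE eqxx.
have zE (j : 'I_k.+1) : (1 <= j)%N -> z j = y j.
  by move=> j_ge1; rewrite ffunE -val_eqE /= gtn_eqF.
have z_lin : C ord0 *m z ord0 = \sum_(i < k.+1 | (1 <= i)%N) C i *m z i.
  rewrite z0 mulmxBr C0p y_lin addrAC subrr add0r.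
  by apply: eq_bigr => j /zE ->.
have z_le0 (j : 'I_k.+1) : (1 <= j)%N -> cvle0 (cvmul (z ord0) (z j)).
  move=> j_ge1 i; rewrite z0 zE // !mxE.
  have [y1|y1] := eqVneq (y (inord 1) i ord0) 0.
    by rewrite (EHLCP_level1_eq0 y_sol i d_pos y1 j) // mulr0.
  have [_ _ y01] := EHLCP_level01 y_sol i.
  have /eqP -> : y ord0 i ord0 == 0 by apply: contraNT y1 => /y01 ->.
  rewrite sub0r mulNr oppr_le0 mulr_ge0 //; first exact/ltW/p_pos.
  exact: EHLCP_level_ge0 y_sol j i.
have z_ge0 (i j : 'I_k.+1) : (1 <= i < j)%N -> cvge0 (cvmul (z i) (z j)).
  move=> /andP[i_ge1 ij] r; rewrite !zE ?(leq_trans i_ge1 (ltnW ij)) // !mxE.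
  by rewrite mulr_ge0 // (EHLCP_level_ge0 y_sol).
have z01 := C_cSW z z_lin z_le0 z_ge0 0 k_ge1.
have y1 i : y (inord 1) i ord0 = 0.
  have [_ _ y01] := EHLCP_level01 y_sol i.
  have [y0|/y01 //] := eqVneq (y ord0 i ord0) 0.
  have := congr1 (fun v : 'cV_n => v i ord0) z01.
  have -> : inord 0 = ord0 :> 'I_k.+1 by apply: val_inj; rewrite /= inordK.
  rewrite z0 zE ?inordK //.
  rewrite !mxE y0 sub0r => /eqP; rewrite mulf_eq0 oppr_eq0 gt_eqF ?p_pos //.
  by move=> /eqP.
have y_eq0 (j : 'I_k.+1) : (1 <= j)%N -> y j = 0.
  move=> j_ge1; apply/matrixP=> i o; rewrite (ord1 o) mxE.
  exact: EHLCP_level1_eq0 y_sol i d_pos (y1 i) j j_ge1.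
apply/ffunP=> j; rewrite ffunE; have [->|] := eqVneq j ord0; last first.
  by rewrite -val_eqE /= -lt0n => /y_eq0 ->.
apply: (can_inj (mulKmx C0_unit)); rewrite C0p y_lin big1 ?addr0 // => i.
by move=> /y_eq0 ->; rewrite mulmx0.
Qed.
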